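(* Let $f:\mathbb{R}^n\to\mathbb{R}$ be twice differentiable, let $A\in\mathbb{R}^{n\times n}$ be invertible, and let $\tilde f(\tilde x) := f(A^{-1}\tilde x)$ be the function $f$ expressed in the variables $\tilde x = Ax$. Let $x_k, x_{k+1}\in\mathbb{R}^n$, $\tilde x_k = A x_k$, $\tilde x_{k+1} = A x_{k+1}$, and set $$ s_k = x_{k+1}-x_k,\quad y_k = \nabla f(x_{k+1}) - \nabla f(x_k),\qquad \tilde s_k = \tilde x_{k+1}-\tilde x_k,\quad \tilde y_k = \nabla \tilde f(\tilde x_{k+1}) - \nabla \tilde f(\tilde x_k). $$ Let $\alpha_k>0$, let $H_k,\tilde H_k\in\mathbb{R}^{n\times n}$ be symmetric positive definite, and let $H_{k+1}$ be the soft QN update of $H_k$ with data $(s_k,y_k,\alpha_k)$ and $\tilde H_{k+1}$ the soft QN update of $\tilde H_k$ with data $(\tilde s_k,\tilde y_k,\alpha_k)$. If $\tilde H_k = A H_k A^T$, then $\tilde H_{k+1} = A H_{k+1} A^T$.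
   Context: Soft QN update: given a symmetric positive definite matrix $H\in\mathbb{R}^{n\times n}$, vectors $s,y\in\mathbb{R}^n$ and a penalty parameter $\alpha>0$, the soft QN update of $H$ with data $(s,y,\alpha)$ is the matrix $$ H^{+} = H + \alpha s s^T - \frac{\alpha}{\gamma^2}\bigl(Hy + \alpha (s^Ty)s\bigr)\bigl(Hy + \alpha (s^Ty)s\bigr)^T,\qquad \gamma = 0.5 + \sqrt{0.25 + \alpha\, y^THy + \alpha^2 (s^Ty)^2}. $$ *)

(* Defs.v *)
From mathcomp Require Import all_boot all_order all_algebra.
From mathcomp Require Import all_classical all_reals all_analysis.

Set Implicit Arguments.
Unset Strict Implicit.
Unset Printing Implicit Defensive.

Import Order.TTheory GRing.Theory Num.Theory.
Import numFieldNormedType.Exports.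

Local Open Scope ring_scope.

Definition gradient (R : realType) (n : nat) (f : 'cV[R]_n -> R)
    (x : 'cV[R]_n) : 'cV[R]_n :=
  \col_(i < n) 'D_(delta_mx i 0) f x.

(* Fréchet sense: the second derivative is the differential of the gradient. *)
Definition twice_differentiable (R : realType) (n : nat)
    (f : 'cV[R]_n -> R) : Prop :=
  (forall x, differentiable f x) /\ (forall x, differentiable (gradient f) x).

Definition dotc (R : realType) (n : nat) (u v : 'cV[R]_n) : R :=
  (u^T *m v) 0 0.

Definition sym_posdef (R : realType) (n : nat) (H : 'M[R]_n) : Prop :=
  H \is symmetricmx /\ (forall v : 'cV[R]_n, v != 0 -> 0 < dotc v (H *m v)).

Definition softqn_gamma (R : realType) (n : nat) (H : 'M[R]_n)
    (s y : 'cV[R]_n) (alpha : R) : R :=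
  2^-1 + Num.sqrt (4^-1 + alpha * dotc y (H *m y) + alpha ^+ 2 * dotc s y ^+ 2).

Definition softqn_update (R : realType) (n : nat) (H : 'M[R]_n)
    (s y : 'cV[R]_n) (alpha : R) : 'M[R]_n :=
  let w := H *m y + (alpha * dotc s y) *: s in
  H + alpha *: (s *m s^T)
    - (alpha / softqn_gamma H s y alpha ^+ 2) *: (w *m w^T).

(* Main.v *)
(* By the chain rule the gradient transforms by A^-T, so y = A^T ty, while
   s transforms by A.  Hence the scalars y^T H y and s^T y, and with them gamma,
   are invariant, and each term of the update is transformed by the congruence
   X |-> A X A^T. *)
Require Import Defs.
From mathcomp Require Import all_boot all_order all_algebra.
From mathcomp Require Import all_classical all_reals all_analysis.

Import Order.TTheory GRing.Theory Num.Theory.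
Import numFieldNormedType.Exports.

Local Open Scope ring_scope.

(** Both sides are limits of the same difference quotient in [h], because [B] sends [h *: v + x] to
    [h *: (B *m v) + B *m x]. *)
Lemma derive_mulmx (R : realType) (n m : nat) (f : 'cV[R]_n -> R)
    (B : 'M[R]_(n, m)) (x v : 'cV[R]_m) :
  'D_v (fun z => f (B *m z)) x = 'D_(B *m v) f (B *m x).
Proof.
rewrite /derive; congr lim; apply: (congr1 (fun g : R -> R => fmap g _)).
apply: funext => h /=.
by rewrite mulmxDr -scalemxAr.
Qed.

Lemma gradient_mulmx (R : realType) (n m : nat) (f : 'cV[R]_n -> R)
    (B : 'M[R]_(n, m)) (x : 'cV[R]_m) :
  differentiable f (B *m x) ->
  gradient (fun z => f (B *m z)) x = B^T *m gradient f (B *m x).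
Proof.
move=> df; apply/matrixP => i j; rewrite {j}ord1 !mxE derive_mulmx deriveE //.
(* The direction is column [i] of [B]; the differential is linear, so it expands into partial
   derivatives of [f] weighted by [B k i]. *)
have -> : B *m delta_mx i 0 = \sum_k B k i *: delta_mx k 0 :> 'cV[R]_n.
  rewrite -colE [LHS]matrix_sum_delta; apply: eq_bigr => k _.
  by rewrite big_ord1 mxE.
rewrite linear_sum; apply: eq_bigr => k _.
by rewrite linearZ /= -deriveE // !mxE.
Qed.

Lemma dotc_mulmx (R : realType) (n m : nat) (A : 'M[R]_(n, m))
    (u : 'cV[R]_m) (v : 'cV[R]_n) :
  dotc (A *m u) v = dotc u (A^T *m v).
Proof. by rewrite /dotc trmx_mul mulmxA. Qed.

Lemma dotcC (R : realType) (n : nat) (u v : 'cV[R]_n) : dotc u v = dotc v u.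
Proof. by rewrite /dotc -[in RHS](trmxK u) -trmx_mul [RHS]mxE. Qed.

(** Here [y] lives in the transformed space and is pulled back by [A^T], so the identity is purely
    algebraic and involves no inverse of [A]. *)
Lemma softqn_update_congr (R : realType) (n m : nat) (A : 'M[R]_(m, n))
    (H : 'M[R]_n) (s : 'cV[R]_n) (y : 'cV[R]_m) (alpha : R) :
  softqn_update (A *m H *m A^T) (A *m s) y alpha =
  A *m softqn_update H s (A^T *m y) alpha *m A^T.
Proof.
have outerE (u : 'cV[R]_n) : (A *m u) *m (A *m u)^T = A *m (u *m u^T) *m A^T.
  by rewrite trmx_mul !mulmxA.
have HyE : A *m H *m A^T *m y = A *m (H *m (A^T *m y)) by rewrite !mulmxA.
have gammaE : softqn_gamma (A *m H *m A^T) (A *m s) y alpha =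
              softqn_gamma H s (A^T *m y) alpha.
  (* [dotc_mulmx] moves [A] off the left argument, so the quadratic form in [y] is flipped, then
     flipped back. *)
  by rewrite /softqn_gamma HyE dotc_mulmx (dotcC _ _ y) dotc_mulmx (dotcC _ _ (H *m _)).
rewrite /softqn_update gammaE HyE dotc_mulmx.
have -> k : A *m (H *m (A^T *m y)) + k *: (A *m s) =
            A *m (H *m (A^T *m y) + k *: s) by rewrite mulmxDr scalemxAr.
rewrite !outerE; move: (H *m _ + _) => w.
by rewrite mulmxBr mulmxDr mulmxBl mulmxDl -!scalemxAr -!scalemxAl.
Qed.

Theorem proposition3p3 (R : realType) (n : nat) (f : 'cV[R]_n -> R)
    (A : 'M[R]_n) (xk xk1 : 'cV[R]_n) (alphak : R) (Hk tHk : 'M[R]_n) :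
  twice_differentiable f ->
  A \in unitmx ->
  0 < alphak ->
  sym_posdef Hk ->
  sym_posdef tHk ->
  let tf := fun tx : 'cV[R]_n => f (invmx A *m tx) in
  let txk := A *m xk in
  let txk1 := A *m xk1 in
  let sk := xk1 - xk in
  let yk := gradient f xk1 - gradient f xk in
  let tsk := txk1 - txk in
  let tyk := gradient tf txk1 - gradient tf txk in
  let Hk1 := softqn_update Hk sk yk alphak in
  let tHk1 := softqn_update tHk tsk tyk alphak in
  tHk = A *m Hk *m A^T ->
  tHk1 = A *m Hk1 *m A^T.
Proof.
move=> [df _] Aunit _ _ _ tf txk txk1 sk yk tsk tyk Hk1 tHk1 tHkE.
(* The chain rule for [invmx A] produces the transpose of [invmx A], which [A^T] cancels. *)
have gradE x : A^T *m gradient tf (A *m x) = gradient f x.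
  by rewrite gradient_mulmx // mulmxA -trmx_mul mulVmx // trmx1 mul1mx mulKmx.
have ykE : yk = A^T *m tyk by rewrite /tyk mulmxBr !gradE.
rewrite /tHk1 /Hk1 tHkE ykE -softqn_update_congr.
by rewrite /tsk /txk /txk1 -mulmxBr.
Qed.
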